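(* A connected graph $G$ (with at least one edge) has exactly two distinct $\mathcal{H}$-eigenvalues if and only if $G\cong K_t\vee(sK_1)$ for some integers $t\ge1$ and $s\ge 2$.
   Context: $K_t\vee(sK_1)$ is the join of the complete graph $K_t$ with $s$ isolated vertices. Graphs are finite, simple and undirected. Fix an orientation of every edge (tail $e^-$, head $e^+$) and a cyclic orientation of every triangle. Let $\mathcal{B}$ be the $|E|\times|V|$ matrix with $b_{ev}=-1$ if $v=e^-$, $1$ if $v=e^+$, $0$ otherwise, and $\mathcal{C}$ the $|T|\times|E|$ matrix ($T$ the set of triangles) with $c_{\vartriangle e}=\pm1$ if $e$ is an edge of $\vartriangle$ (sign $+$ iff the orientation of $e$ agrees with that of $\vartriangle$) and $0$ otherwise. The Helmholtzian matrix is $\mathcal{H}(G)=\mathcal{B}\mathcal{B}^{\intercal}+\mathcal{C}^{\intercal}\mathcal{C}$; its eigenvalues ($\mathcal{H}$-eigenvalues) do not depend on the chosen orientations. *)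

(* Defs.v *)
From HB Require Import structures.
From mathcomp Require Import all_boot all_order all_algebra all_fingroup.

Set Implicit Arguments.
Unset Strict Implicit.
Unset Printing Implicit Defensive.

Import GRing.Theory.
Local Open Scope ring_scope.

Record sgraph := SGraph {
  vertex :> finType;
  adj : rel vertex;
  adj_sym : symmetric adj;
  adj_irrefl : irreflexive adj }.

Definition connected_graph (G : sgraph) : Prop :=
  forall x y : G, connect (@adj G) x y.

Definition isomorphic (G H : sgraph) : Prop :=
  exists2 f : G -> H, bijective f & forall x y : G, adj (f x) (f y) = adj x y.

Section Examples.

Fact complete_sym n : symmetric (fun i j : 'I_n => i != j).
Proof. by move=> i j; rewrite eq_sym. Qed.

Fact complete_irrefl n : irreflexive (fun i j : 'I_n => i != j).
Proof. by move=> i; rewrite eqxx. Qed.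

Definition complete_graph (n : nat) : sgraph :=
  SGraph (@complete_sym n) (@complete_irrefl n).

Definition edgeless_graph (n : nat) : sgraph :=
  @SGraph 'I_n (fun _ _ => false) (fun _ _ => erefl) (fun _ => erefl).

Variables G H : sgraph.

Definition join_adj (u v : G + H) : bool :=
  match u, v with
  | inl x, inl y => adj x y
  | inr x, inr y => adj x y
  | _, _ => true
  end.

Fact join_sym : symmetric join_adj.
Proof. by move=> [x|x] [y|y] //=; exact: adj_sym. Qed.

Fact join_irrefl : irreflexive join_adj.
Proof. by move=> [x|x] /=; exact: adj_irrefl. Qed.

Definition graph_join : sgraph := SGraph join_sym join_irrefl.

End Examples.

Definition edges (G : sgraph) : {set {set G}} :=
  [set e | [exists x : G, exists y : G, adj x y && (e == [set x; y])]].

Definition triangles (G : sgraph) : {set {set G}} :=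
  [set T : {set G} |
    (#|T| == 3) && [forall x in T, forall y in T, (x != y) ==> adj x y]].

(* A cyclic orientation of a triangle is encoded by its successor map: a
   permutation of the three vertices without fixed point, that is, one of the
   two 3-cycles. The values of [etail], [ehead] and [tnext] outside [edges G],
   resp. [triangles G], are irrelevant. *)
Record orientation (G : sgraph) := Orientation {
  etail : {set G} -> G;
  ehead : {set G} -> G;
  tnext : {set G} -> {perm G};
  edge_ends : forall e, e \in edges G -> e = [set etail e; ehead e];
  tnext_on : forall T, T \in triangles G -> perm_on T (tnext T);
  tnext_neq : forall T x, T \in triangles G -> x \in T -> tnext T x != x }.

Section Helmholtzian.

Variables (R : pzRingType) (G : sgraph) (o : orientation G).

Definition incidence_coef (e : {set G}) (v : G) : R :=
  if v == etail o e then -1 else if v == ehead o e then 1 else 0.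

Definition curl_coef (T e : {set G}) : R :=
  if e \subset T then (if tnext o T (etail o e) == ehead o e then 1 else -1)
  else 0.

Definition incidence_mx : 'M[R]_(#|edges G|, #|G|) :=
  \matrix_(i, j) incidence_coef (enum_val i) (enum_val j).

Definition curl_mx : 'M[R]_(#|triangles G|, #|edges G|) :=
  \matrix_(i, j) curl_coef (enum_val i) (enum_val j).

Definition helmholtzian : 'M[R]_#|edges G| :=
  incidence_mx *m incidence_mx^T + curl_mx^T *m curl_mx.

End Helmholtzian.

Definition two_distinct_eigenvalues (F : fieldType) (n : nat) (A : 'M[F]_n) :
    Prop :=
  exists a b : F, a != b /\ forall x : F, eigenvalue A x <-> x = a \/ x = b.

(* Main.v *)
(** Two edges of a common triangle have Helmholtzian entry 0 (the gradient and
    curl parts cancel), two edges uv, uw with v, w non-adjacent have entry +-1,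
    and disjoint edges have entry 0.  If H has only two eigenvalues a, b, then
    (H - a)(H - b) = 0 by the spectral theorem, so H^2 vanishes at every
    off-diagonal position where H does.  Read at two disjoint edges this excludes
    induced P4 and C4; read at two edges of a triangle it excludes the induced
    paw.  In a connected graph without induced P4 and paw non-adjacency is
    transitive, and excluding C4 leaves at most one class with more than one
    vertex: the vertices that do not dominate form an independent set.
    Conversely, if A is the set of dominating vertices and the other vertices are
    independent, H is explicit and (H - |A|)(H - |V|) = 0. *)

Require Import Defs.
From mathcomp Require Import all_boot all_order all_algebra all_fingroup.
From mathcomp Require Import ring complex.

Set Implicit Arguments.
Unset Strict Implicit.
Unset Printing Implicit Defensive.

Import Order.TTheory GRing.Theory Num.Theory.
Local Open Scope ring_scope.

(** * Spectral theorem for symmetric matrices *)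

(** Over [R[i]] the matrix is Hermitian, hence unitarily diagonalizable with real diagonal; the
    product vanishes on the diagonal form, and the identity descends because [R] embeds in
    [R[i]]. *)
Lemma sym_two_eigenvalues_annul (R : rcfType) n (A : 'M[R]_n) (a b : R) :
    A^T = A -> (forall x, eigenvalue A x -> x = a \/ x = b) ->
  (A - a%:M) *m (A - b%:M) = 0.
Proof.
move=> symA spA; pose f : {rmorphism R -> R[i]} := real_complex R.
pose B := map_mx f A.
have hermB : B \is hermsymmx.
  apply/is_hermitianmxP; rewrite expr0 scale1r; apply/matrixP=> i j.
  by rewrite !mxE -[in LHS]symA mxE; apply/esym/CrealP/complex_realP; exists (A j i).
have /hermitian_normalmx/orthomx_spectralP := hermB.
set P := spectralmx B; set d := spectral_diag B => defB.
have uP : P \in unitmx by exact: spectral_unit.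
have spd i : d 0 i = f a \/ d 0 i = f b.
  have /mxOverP/(_ 0 i)/complex_realP[x dx] := hermitian_spectral_diag_real hermB.
  rewrite -/d in dx; suff /spA[<-|<-] : eigenvalue A x; [by left | by right |].
  rewrite -(eigenvalue_map f) -/B; apply/eigenvalueP.
  (* Row [i] of the diagonalizing matrix is a left eigenvector for [d 0 i]; it is nonzero because
     [P] is invertible. *)
  exists (row i P); last first.
    apply: contraTneq uP => Pi0; rewrite -row_free_unit -kermx_eq0.
    apply/rowV0Pn; exists (delta_mx 0 i); last first.
      by apply/eqP=> /matrixP/(_ 0 i)/eqP; rewrite !mxE !eqxx oner_eq0.
    by apply/sub_kermxP; rewrite -rowE.
  by rewrite -row_mul defB !mulmxA mulmxV // mul1mx row_mul row_diag_mx
    -scalemxAl -rowE dx.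
have BE c : B - (f c)%:M = invmx P *m diag_mx (d - const_mx (f c)) *m P.
  have -> : diag_mx (d - const_mx (f c)) = diag_mx d - (f c)%:M.
    by rewrite linearB /= diag_const_mx.
  by rewrite mulmxBr mulmxBl -defB mul_mx_scalar -scalemxAl mulVmx // scalemx1.
apply: (@map_mx_inj _ _ f); rewrite map_mxM !map_mxB !map_scalar_mx map_mx0 -/B.
rewrite !BE !mulmxA mulmxK // -(mulmxA (invmx P)) mulmx_diag.
rewrite (_ : (\row__ _) = 0) ?diag_mx0 ?linear0 ?mulmx0 ?mul0mx //.
apply/rowP=> i; rewrite !mxE; apply/eqP; rewrite mulf_eq0 !subr_eq0.
by case: (spd i) => ->; rewrite eqxx ?orbT.
Qed.

(** * Edges and triangles as vertex sets *)

Section GraphFacts.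

Variable G : sgraph.
Implicit Types (u v w x y : G) (e f : {set G}).

Lemma adj_neq u v : adj u v -> u != v.
Proof. by apply: contraTneq => ->; rewrite adj_irrefl. Qed.

Lemma edgesP e : reflect (exists u v, adj u v /\ e = [set u; v]) (e \in edges G).
Proof.
rewrite inE; apply: (iffP existsP) => [[u /existsP[v /andP[uv /eqP]]]|].
  by exists u, v.
by case=> u [v [uv ->]]; exists u; apply/existsP; exists v; rewrite uv eqxx.
Qed.

Lemma mem_edges u v : adj u v -> [set u; v] \in edges G.
Proof. by move=> uv; apply/edgesP; exists u, v. Qed.

Lemma edge_at e u : e \in edges G -> u \in e -> exists2 v, adj u v & e = [set u; v].
Proof.
case/edgesP=> x [y [xy ->]] /set2P[->|->]; first by exists y.
by exists x; rewrite 1?adj_sym // setUC.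
Qed.

Lemma edge_of_ends u v e : adj u v -> e \in edges G -> u \in e -> v \in e ->
  e = [set u; v].
Proof.
move=> uv eE ue; have [w uw ->] := edge_at eE ue.
by rewrite !inE eq_sym (negPf (adj_neq uv)) => /eqP->.
Qed.

Lemma triangle3 u v w : adj u v -> adj u w -> adj v w ->
  [set u; v; w] \in triangles G.
Proof.
move=> uv uw vw; rewrite inE; apply/andP; split.
  rewrite setUC cardsU1 !inE negb_or ![w == _]eq_sym (adj_neq uw) (adj_neq vw).
  by rewrite cards2 (adj_neq uv).
apply/forall_inP=> x; rewrite !inE -orbA => /or3P[]/eqP->;
  apply/forall_inP=> y; rewrite !inE -orbA => /or3P[]/eqP->;
  apply/implyP; rewrite ?eqxx // => _; by rewrite // adj_sym.
Qed.

Lemma triangle_adj T u v : T \in triangles G -> u \in T -> v \in T -> u != v ->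
  adj u v.
Proof.
rewrite inE => /andP[_ /forall_inP aT] uT vT.
by have /forall_inP/(_ v vT)/implyP := aT u uT.
Qed.

Lemma triangle_eq3 T u v w : T \in triangles G ->
  u \in T -> v \in T -> w \in T -> u != v -> u != w -> v != w ->
  T = [set u; v; w].
Proof.
move=> TT uT vT wT uv uw vw; apply/eqP; rewrite eq_sym eqEcard.
have:= TT; rewrite inE => /andP[/eqP-> _]; apply/andP; split.
  by rewrite !subUset !sub1set uT vT.
by rewrite setUC cardsU1 !inE negb_or ![w == _]eq_sym uw vw cards2 uv.
Qed.

End GraphFacts.

(** * Entries of the Helmholtzian matrix *)

Section Entries.

Variables (R : realDomainType) (G : sgraph) (o : orientation G).
Implicit Types (u v w x y : G) (e f g T : {set G}).

(** Indexing by vertex sets instead of ordinals lets an edge be written [[set u; v]]. *)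
Definition helm e f : R :=
  \sum_v incidence_coef R o e v * incidence_coef R o f v
  + \sum_(T in triangles G) curl_coef R o T e * curl_coef R o T f.

(* +1 if the edge [uv] is oriented towards [u], -1 if away from it. *)
Definition sgn u v : R := incidence_coef R o [set u; v] u.

Lemma helmholtzianE i j : helmholtzian R o i j = helm (enum_val i) (enum_val j).
Proof.
rewrite !mxE; congr (_ + _).
  rewrite [RHS](reindex_onto (enum_val : 'I_#|G| -> G) enum_rank) /=.
    by apply: eq_big => [k|k _]; rewrite ?enum_valK ?eqxx // !mxE.
  by move=> v _; rewrite enum_rankK.
rewrite [RHS]big_enum_val; apply: eq_bigr => k _; by rewrite !mxE.
Qed.

Lemma helmC e f : helm e f = helm f e.
Proof. by congr (_ + _); apply: eq_bigr => i _; rewrite mulrC. Qed.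

Lemma edge_ends_adj u v : adj u v ->
  (etail o [set u; v] = u /\ ehead o [set u; v] = v)
  \/ (etail o [set u; v] = v /\ ehead o [set u; v] = u).
Proof.
move=> uv; have := edge_ends o (mem_edges uv).
move: (etail _ _) (ehead _ _) => t h defe; have nuv := negPf (adj_neq uv).
have [ue ve] : u \in [set t; h] /\ v \in [set t; h] by rewrite -defe set21 set22.
have : t \in [set u; v] by rewrite defe set21.
case/set2P=> tE; [left | right]; split=> //; move: ue ve; rewrite tE !inE ?eqxx.
  by rewrite [v == u]eq_sym nuv => _ /eqP.
by rewrite nuv => /eqP.
Qed.

Lemma incidence_coef0 e v : e \in edges G -> v \notin e ->
  incidence_coef R o e v = 0.
Proof.
case/edgesP=> x [y [xy ->]]; rewrite !inE negb_or => /andP[vx vy].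
rewrite /incidence_coef.
by case: (edge_ends_adj xy) => -[-> ->]; rewrite (negPf vx) (negPf vy).
Qed.

Lemma sgn_anti u v : adj u v -> sgn v u = - sgn u v.
Proof.
move=> uv; have nuv := negPf (adj_neq uv); rewrite /sgn (setUC [set v]) /incidence_coef.
by case: (edge_ends_adj uv) => -[-> ->]; rewrite ?eqxx ?nuv ?[v == u]eq_sym ?nuv ?opprK.
Qed.

Lemma sgn_sqr u v : adj u v -> sgn u v * sgn u v = 1.
Proof.
move=> uv; have nuv := negPf (adj_neq uv); rewrite /sgn /incidence_coef.
by case: (edge_ends_adj uv) => -[-> ->]; rewrite ?eqxx ?nuv ?[v == u]eq_sym ?nuv ?mulrNN mulr1.
Qed.

Lemma helm_disjoint e f : e \in edges G -> f \in edges G -> [disjoint e & f] ->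
  helm e f = 0.
Proof.
move=> eE fE dis; rewrite /helm !big1 ?addr0 // => [T TT|v _].
  rewrite /curl_coef; case: (boolP (e \subset T)) => [eT|_]; last by rewrite mul0r.
  case: (boolP (f \subset T)) => [fT|_]; last by rewrite mulr0.
  suff : (4 <= #|T|)%N by have:= TT; rewrite inE => /andP[/eqP-> _].
  have <- : #|e :|: f| = 4%N.
    rewrite cardsU disjoint_setI0 // cards0 subn0.
    case/edgesP: eE => a [b [/adj_neq ab ->]]; case/edgesP: fE => c [d [/adj_neq cd ->]].
    by rewrite !cards2 ab cd.
  by rewrite subset_leq_card // subUset eT.
have [ve|ve] := boolP (v \in e); last by rewrite (incidence_coef0 eE) // mul0r.
by rewrite (incidence_coef0 fE) ?mulr0 //; rewrite (disjointFr dis ve).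
Qed.

(** The triangle runs from [u] to [v], which agrees with the edge exactly when [u] is its tail, that
    is, when [sgn u v] is -1. *)
Lemma curl_tnext T u v : T \in triangles G -> adj u v -> u \in T -> v \in T ->
  tnext o T u = v -> tnext o T v != u -> curl_coef R o T [set u; v] = - sgn u v.
Proof.
move=> TT uv uT vT tu /negPf tv; have nuv := negPf (adj_neq uv).
rewrite /curl_coef subUset !sub1set uT vT /= /sgn /incidence_coef.
case: (edge_ends_adj uv) => -[-> ->].
  by rewrite tu !eqxx opprK.
by rewrite tv nuv eqxx.
Qed.

(** A cyclic orientation enters [u] along one of the two edges and leaves along the other, which
    reverses the relative sign seen at [u]. *)
Lemma curl_angle u v w (T := [set u; v; w]) : adj u v -> adj u w -> adj v w ->
  curl_coef R o T [set u; v] * curl_coef R o T [set u; w] = - (sgn u v * sgn u w).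
Proof.
move=> uv uw vw; have TT : T \in triangles G by exact: triangle3.
have [uT vT wT] : [/\ u \in T, v \in T & w \in T] by rewrite !inE !eqxx ?orbT.
have nuv := adj_neq uv; have nuw := adj_neq uw; have nvw := adj_neq vw.
have tinj : injective (tnext o T) by exact: perm_inj.
have tT x : x \in T -> tnext o T x \in T by rewrite (perm_closed _ (tnext_on o TT)).
have tN x : x \in T -> tnext o T x != x by exact: tnext_neq.
(* The successor of [u] is [v] or [w], and the claim is symmetric in these two. *)
wlog tu : v w @T uv uw vw TT uT vT wT nuv nuw nvw tinj tT tN / tnext o T u = v.
  move=> IH; have: tnext o T u \in [set u; v; w] by exact: tT.
  rewrite !inE -orbA (negPf (tN _ uT)) /= => /orP[]/eqP tu; first exact: IH.
  have eT : T = [set u; w; v] by rewrite /T -!setUA (setUC [set v]).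
  rewrite mulrC [in RHS]mulrC eT; apply: IH => //; rewrite -?eT //; first by rewrite adj_sym.
  by rewrite eq_sym.
have tw : tnext o T w = u.
  have: tnext o T w \in [set u; v; w] by exact: tT.
  rewrite !inE -orbA (negPf (tN _ wT)) orbF => /orP[]/eqP // tw.
  by case/eqP: nuw; apply: tinj; rewrite tu tw.
rewrite (@curl_tnext _ u v) //; last by apply: contraNneq nvw => tv; apply/eqP/tinj; rewrite tv tw.
rewrite (setUC [set u] [set w]) (@curl_tnext _ w u) 1?adj_sym // ?tu //.
by rewrite (sgn_anti uw) opprK mulNr.
Qed.

(** Only the vertex [u] contributes to the gradient part and only the triangle [uvw], if present, to
    the curl part; by [curl_angle] the two contributions are opposite. *)
Lemma helm_angle u v w : adj u v -> adj u w -> v != w ->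
  helm [set u; v] [set u; w] = if adj v w then 0 else sgn u v * sgn u w.
Proof.
move=> uv uw nvw; have nuv := adj_neq uv; have nuw := adj_neq uw.
rewrite /helm (bigD1 u) //= -/(sgn u v) -/(sgn u w) [X in _ + X + _]big1 ?addr0; last first.
  move=> x xu; have [->|xv] := eqVneq x v.
    by rewrite (incidence_coef0 (mem_edges uw)) ?mulr0 // !inE negb_or eq_sym nuv.
  by rewrite (incidence_coef0 (mem_edges uv)) ?mul0r // !inE negb_or xu.
have T0 T : T \in triangles G -> T != [set u; v; w] ->
    curl_coef R o T [set u; v] * curl_coef R o T [set u; w] = 0.
  move=> TT nT; rewrite /curl_coef; case: (boolP ([set u; v] \subset T)) => [|_]; last by rewrite mul0r.
  case: (boolP ([set u; w] \subset T)) => [|_]; last by rewrite mulr0.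
  rewrite !subUset !sub1set => /andP[uT wT] /andP[_ vT].
  by case/eqP: nT; apply: triangle_eq3.
case: ifP => [vw|/negbT vw].
  rewrite (bigD1 [set u; v; w]) ?triangle3 //= curl_angle // big1 ?addr0 ?subrr //.
  by move=> T /andP[]; exact: T0.
rewrite big1 ?addr0 // => T TT; apply: (T0) => //; apply: contraNneq vw => eT.
by apply: (triangle_adj TT); rewrite // eT !inE eqxx ?orbT.
Qed.

(** Each endpoint contributes 1, and so does each triangle on the edge; these triangles correspond
    to the common neighbours of [u] and [v]. *)
Lemma helm_diag u v : adj u v ->
  helm [set u; v] [set u; v] = (2 + #|[set w | adj u w && adj v w]|)%:R.
Proof.
move=> uv; have nuv := adj_neq uv; rewrite natrD /helm; congr (_ + _).
  rewrite (bigD1 u) //= (bigD1 v) 1?eq_sym //= -/(sgn u v) (sgn_sqr uv).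
  rewrite (setUC [set u]) -/(sgn v u) sgn_sqr 1?adj_sym // big1 ?addr0 //.
  by move=> x /andP[xu xv]; rewrite incidence_coef0 ?mul0r 1?setUC ?mem_edges // !inE negb_or xu.
transitivity (\sum_(T in [set [set u; v; w] | w in [set w | adj u w && adj v w]]) (1 : R)).
  rewrite (bigID (fun T => [set u; v] \subset T)) /= [X in _ + X]big1 ?addr0; last first.
    by move=> T /andP[_ /negPf nT]; rewrite /curl_coef nT mul0r.
  apply: eq_big => [T|T /andP[_ eT]]; last first.
    by rewrite /curl_coef eT; case: ifP; rewrite ?mulrNN mulr1.
  apply/andP/imsetP => [[TT]|[w]]; last first.
    by rewrite inE => /andP[uw vw] ->; rewrite triangle3 // subsetUl.
  move=> eT; have cT : #|T :\: [set u; v]| = 1%N.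
    rewrite cardsD (setIidPr eT) cards2 nuv.
    by have:= TT; rewrite inE => /andP[/eqP-> _].
  have /cards1P[w /setP] := introT eqP cT.
  move/(_ w); rewrite !inE eqxx negb_or => /andP[/andP[wu wv] wT].
  move: eT; rewrite subUset !sub1set => /andP[uT vT].
  exists w; last by apply: triangle_eq3; rewrite // eq_sym.
  by rewrite inE !(triangle_adj TT) // eq_sym.
rewrite sumr_const card_in_imset // => w x; rewrite !inE => /andP[uw vw] _.
move/setP/(_ w); rewrite !inE eqxx orbT => /esym.
by rewrite ![w == _]eq_sym (negPf (adj_neq uw)) (negPf (adj_neq vw)) [_ == w]eq_sym => /eqP.
Qed.

End Entries.

(** * Forbidden induced subgraphs *)

(** This is the join of a complete graph on [A] with isolated vertices off [A], stated without an
    isomorphism; either side may be empty. *)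
Definition dominated_by (G : sgraph) (A : {set G}) :=
  forall x y : G, adj x y = (x != y) && ((x \in A) || (y \in A)).

Section ForbiddenSubgraphs.

Variables (R : realDomainType) (G : sgraph) (o : orientation G).
Implicit Types (u v w x y : G) (e f g : {set G}).

Let h := helm R o.
Let s := sgn R o.

Hypothesis sq_orth : forall e f, e \in edges G -> f \in edges G -> e != f ->
  h e f = 0 -> \sum_(g in edges G) h e g * h g f = 0.

(* To exclude an induced subgraph, multiply a vanishing sum by the sign of its
   nonzero terms: all terms become nonnegative. *)
Lemma sq_terms_eq0 e f (c : R) : e \in edges G -> f \in edges G -> e != f ->
    h e f = 0 -> (forall g, g \in edges G -> 0 <= c * (h e g * h g f)) ->
  forall g, g \in edges G -> c * (h e g * h g f) = 0.
Proof.
move=> eE fE nef hef cge0; apply/psumr_eq0P => //.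
by rewrite -mulr_sumr sq_orth // mulr0.
Qed.

Lemma not_disjoint_ex e g : ~~ [disjoint e & g] -> exists2 x, x \in e & x \in g.
Proof. by rewrite -setI_eq0 => /set0Pn[x /setIP[]]; exists x. Qed.

(** The path is [v], [u], [x], [y]; leaving the adjacency of [v] and [y] open covers P4 and C4 at
    once. Between the disjoint edges [uv] and [xy], the edge [ux] gives a nonzero term, and [vy], if
    it is an edge, cannot cancel it. *)
Lemma no_induced_P4_C4 u v x y : adj u v -> adj x y -> adj u x ->
  ~~ adj v x -> ~~ adj u y -> v != x -> u != y -> False.
Proof.
move=> uv xy ux vx uy nvx nuy.
have [vu yx xu] : [/\ adj v u, adj y x & adj x u] by split; rewrite adj_sym.
have nvy : v != y by apply: contraNneq vx => ->.
have nux := adj_neq ux.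
have dis : [disjoint [set u; v] & [set x; y]].
  rewrite -setI_eq0; apply: contraT => /set0Pn[z /setIP[/set2P[]->]]; rewrite !inE.
    by rewrite (negPf nux) (negPf nuy).
  by rewrite (negPf nvx) (negPf nvy).
have ne : [set u; v] != [set x; y].
  by apply: contraTneq (nux) => /setP/(_ u); rewrite !inE eqxx (negPf nux) (negPf nuy).
have eE := mem_edges uv; have fE := mem_edges xy.
have hux : h [set u; v] [set u; x] * h [set u; x] [set x; y] = - (s u v * s x y).
  rewrite /h helm_angle // (negPf vx) (setUC [set u] [set x]) helm_angle // (negPf uy).
  rewrite (sgn_anti _ _ ux) -!/(s _ _) mulrACA mulrN -[RHS]mulN1r -(sgn_sqr R o ux).
  by rewrite -/(s _ _); ring.
have := @sq_terms_eq0 _ _ (- (s u v * s x y)) eE fE ne (helm_disjoint R o eE fE dis) _ _ (mem_edges ux).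
rewrite hux mulrNN mulrACA !sgn_sqr // mulr1 => /(_ _)/eqP.
(* The term at [ux] is 1 after scaling, so nonnegativity of all terms is all that remains to be
   shown. *)
rewrite oner_eq0 => H; apply: notF; apply: H => g gE.
have [eg|/not_disjoint_ex[p pe pg]] := boolP [disjoint [set u; v] & g].
  by rewrite /h (helm_disjoint _ _ eE gE eg) mul0r mulr0.
have [fg|/not_disjoint_ex[q qf qg]] := boolP [disjoint [set x; y] & g].
  by rewrite /h (helmC _ _ g) (helm_disjoint _ _ fE gE fg) !mulr0.
(* An edge meeting both [uv] and [xy] joins an end of one to an end of the other; only [ux] and [vy]
   are possible. *)
have npq : q != p by apply: contraTneq qf => ->; rewrite (disjointFr dis pe).
have [r pr defg] := edge_at gE pg.
have {}qr : q = r by move: qg; rewrite defg !inE (negPf npq) => /eqP.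
rewrite {}defg -{}qr {g gE pg qg} in pr *.
case/set2P: pe qf pr npq => -> /set2P[]->; rewrite ?(negPf uy) ?(negPf vx) // => pr npq.
  by rewrite hux mulrNN mulrACA !sgn_sqr // mulr1 ler01.
rewrite /h (setUC [set u]) helm_angle // (negPf uy) (setUC [set v] [set y]).
rewrite (setUC [set x]) helm_angle 1?adj_sym // [adj x v]adj_sym (negPf vx).
rewrite (sgn_anti _ _ uv) (sgn_anti _ _ xy) (sgn_anti _ _ pr) -!/(s _ _).
set a := s u v; set b := s x y; set c := s v y.
have -> : - (a * b) * (- a * c * (- c * - b)) = (a * b * c) ^+ 2 by ring.
exact: sqr_ge0.
Qed.

(** The pendant edge [ux] gives a nonzero term between the triangle edges [uv] and [uw]. Any other
    edge at [u] gives 0 or the same sign, and an edge off [u] meeting both is [vw], whose term is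
    0. *)
Lemma no_induced_paw u v w x : adj u v -> adj u w -> adj u x -> adj v w ->
  ~~ adj v x -> ~~ adj w x -> v != x -> w != x -> False.
Proof.
move=> uv uw ux vw vx wx nvx nwx; have nvw := adj_neq vw; have nuv := adj_neq uv.
have eE := mem_edges uv; have fE := mem_edges uw; have wv : adj w v by rewrite adj_sym.
have ne : [set u; v] != [set u; w].
  by apply: contraTneq (nvw) => /setP/(_ v); rewrite !inE eqxx [v == u]eq_sym (negPf nuv) /= => <-.
have hef : h [set u; v] [set u; w] = 0 by rewrite /h helm_angle // vw.
have hS y : adj u y -> v != y -> w != y -> ~~ adj v y -> ~~ adj w y ->
    s u v * s u w * (h [set u; v] [set u; y] * h [set u; y] [set u; w]) = 1.
  move=> uy nvy nwy /negPf vy /negPf wy.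
  rewrite /h helm_angle // vy (helmC _ _ [set u; y]) helm_angle // wy.
  transitivity ((s u v * s u v) * (s u w * s u w) * (s u y * s u y)).
    by rewrite /s; ring.
  by rewrite !sgn_sqr // !mulr1.
have := @sq_terms_eq0 _ _ (s u v * s u w) eE fE ne hef _ _ (mem_edges ux).
rewrite hS // => /(_ _)/eqP; rewrite oner_eq0 => H; apply: notF; apply: H => g gE.
have [ug|ug] := boolP (u \in g).
  have [y uy ->] := edge_at gE ug.
  have [<-|nvy] := eqVneq v y; first by rewrite hef !mulr0.
  have [<-|nwy] := eqVneq w y; first by rewrite hef mul0r mulr0.
  have [vy|vy] := boolP (adj v y); first by rewrite /h helm_angle // vy mul0r mulr0.
  have [wy|wy] := boolP (adj w y).
    by rewrite /h (helmC _ _ [set u; y]) (helm_angle _ _ uw) // wy !mulr0.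
  by rewrite hS ?ler01.
have [eg|/not_disjoint_ex[p pe pg]] := boolP [disjoint [set u; v] & g].
  by rewrite /h (helm_disjoint _ _ eE gE eg) mul0r mulr0.
have [fg|/not_disjoint_ex[q qf qg]] := boolP [disjoint [set u; w] & g].
  by rewrite /h (helmC _ _ g) (helm_disjoint _ _ fE gE fg) !mulr0.
have vg : v \in g by case/set2P: pe pg => ->; rewrite // (negPf ug).
have wg : w \in g by case/set2P: qf qg => ->; rewrite // (negPf ug).
rewrite (edge_of_ends vw gE vg wg) /h (setUC [set u]) helm_angle ?(adj_neq uw) //.
  by rewrite uw mul0r mulr0.
by rewrite adj_sym.
Qed.

Hypothesis G_connected : connected_graph G.

(** Diameter at most 2, by induction along a path from [x]: if the midpoint [m] for the penultimate
    vertex [y] misses the last vertex [t], then [x], [m], [y], [t] is an induced P4. *)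
Lemma common_neighbour x z : x != z -> ~~ adj x z -> exists2 m, adj x m & adj m z.
Proof.
have /connectP[p pth ->] := G_connected x z; move: pth.
elim/last_ind: p => [|p t IH]; first by rewrite /= eqxx.
rewrite rcons_path last_rcons => /andP[/IH{IH}]; set y := last x p => IH yt nxt xt.
have [xy|nxy] := eqVneq x y; first by rewrite xy yt in xt.
have [xy|xy] := boolP (adj x y); first by exists y.
have [m xm my] := IH nxy xy.
have [mt|mt] := boolP (adj m t); first by exists m.
case: (@no_induced_P4_C4 m x y t); rewrite // 1?adj_sym //.
by apply: contraNneq xt => <-.
Qed.

(** Let [m] be a common neighbour of [x] and [z], and suppose [x] and [y] adjacent. If [m] is
    adjacent to [y], the triangle [mxy] with pendant [z] is a paw; otherwise [y], [x], [m], [z] is a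
    P4. *)
Lemma nonadj_trans y x z : ~~ adj x z -> ~~ adj z y -> x != z -> z != y -> ~~ adj x y.
Proof.
move=> xz zy nxz nzy; apply/negP=> xy; have [m xm mz] := common_neighbour nxz xz.
have yz : ~~ adj y z by rewrite adj_sym.
have [my|my] := boolP (adj m y).
  by apply: (@no_induced_paw m x y z); rewrite // 1?adj_sym // 1?eq_sym.
apply: (@no_induced_P4_C4 x y m z); rewrite // 1?adj_sym //.
by apply: contraNneq yz => ->.
Qed.

Lemma exists_dominating : dominated_by [set x : G | [forall y, (x != y) ==> adj x y]].
Proof.
have ndomP x : x \notin [set x : G | [forall y, (x != y) ==> adj x y]] ->
    exists2 y, x != y & ~~ adj x y.
  by rewrite inE negb_forall => /existsP[y]; rewrite negb_imply => /andP[]; exists y.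
move=> x y; have [->|nxy] := eqVneq x y; first by rewrite adj_irrefl.
have [|xA] /= := boolP (x \in _); first by rewrite inE => /forallP/(_ y); rewrite nxy.
have [|yA] /= := boolP (y \in _).
  by rewrite inE => /forallP/(_ x); rewrite eq_sym nxy adj_sym.
apply/negP=> xy; have yx : adj y x by rewrite adj_sym.
(* Adjacent non-dominating [x] and [y] have non-neighbours [x'] and [y']. By transitivity [x] is
   adjacent to [y'] and [y] to [x'], so [y'], [x], [y], [x'] is a forbidden path. *)
have [x' nx xx'] := ndomP x xA; have [y' ny yy'] := ndomP y yA.
have xy' : adj x y'.
  apply: contraTT xy => xy'; have [->//|nxy'] := eqVneq x y'.
    by rewrite adj_sym.
  by apply: (@nonadj_trans _ _ y'); rewrite // 1?adj_sym // 1?eq_sym.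
have yx' : adj y x'.
  apply: contraTT yx => yx'; have [->//|nyx'] := eqVneq y x'.
    by rewrite adj_sym.
  by apply: (@nonadj_trans _ _ x'); rewrite // 1?adj_sym // 1?eq_sym.
by apply: (@no_induced_P4_C4 x y' y x'); rewrite // 1?adj_sym // 1?eq_sym.
Qed.

End ForbiddenSubgraphs.

(** * The spectrum of a graph with dominating set [A] *)

Section Dominated.

Variables (R : realDomainType) (G : sgraph) (o : orientation G) (A : {set G}).
Hypothesis domA : dominated_by A.
Implicit Types (u v w x y : G) (e f g : {set G}).

Lemma dominated_adj u v : u \in A -> u != v -> adj u v.
Proof. by move=> uA uv; rewrite domA uv uA. Qed.

(** All other vertices are common neighbours of [u] and [v]. So the diagonal entry is 2 + ([#|G|] -
    2), and every edge meeting [uv] in one vertex spans a triangle with it. *)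
Lemma helm_dominating_edge u v g : u \in A -> v \in A -> u != v -> g \in edges G ->
  helm R o [set u; v] g = #|G|%:R *+ ([set u; v] == g).
Proof.
move=> uA vA nuv gE; have uv := dominated_adj uA nuv.
have [<-|neg] := eqVneq.
  rewrite helm_diag // (_ : [set w | _] = ~: [set u; v]).
    by rewrite -(cardsC [set u; v]) cards2 nuv.
  by apply/setP=> w; rewrite !inE !domA uA vA !andbT negb_or ![w == _]eq_sym.
have [eg|/not_disjoint_ex[p pe pg]] := boolP [disjoint [set u; v] & g].
  by rewrite (helm_disjoint R o (mem_edges uv) gE eg).
have [w pw defg] := edge_at gE pg.
have hA x y : x \in A -> y \in A -> adj x y -> y != w -> adj x w ->
    helm R o [set x; y] [set x; w] = 0.
  by move=> xA yA xy yw xw; rewrite helm_angle // (dominated_adj yA yw).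
case/set2P: pe pw defg => -> pw defg.
  by rewrite defg hA //; apply: contraNneq neg => ->; rewrite defg.
rewrite defg setUC hA //; first by rewrite adj_sym.
by apply: contraNneq neg => ->; rewrite defg setUC.
Qed.

(** For [u] in [A], this is the signed indicator vector, over the edges [g], of the edges from [u]
    to the complement of [A]. *)
Definition spoke u g : R := \sum_(w in ~: A) sgn R o u w *+ (g == [set u; w]).

(** The common neighbours of [u] and [v] are the rest of [A], so the diagonal entry is [#|A|] + 1,
    the 1 being a squared sign. Two edges from [u] to the complement span no triangle; any other
    edge meeting [uv] in one vertex does. *)
Lemma helm_spoke u v g : u \in A -> v \notin A -> g \in edges G ->
  helm R o [set u; v] g = #|A|%:R *+ ([set u; v] == g) + sgn R o u v * spoke u g.
Proof.
move=> uA vA gE; have nuv : u != v by apply: contraNneq vA => <-.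
have uv := dominated_adj uA nuv.
have eqS w : w \notin A -> ([set u; w] == [set u; v]) = (w == v).
  move=> wA; apply/eqP/eqP=> [/setP/(_ w)|->//].
  by rewrite !inE eqxx orbT; case: eqP wA uA => [->/negPf->//|_ _ _ /esym/eqP].
have spokeE w : w \notin A -> spoke u [set u; w] = sgn R o u w.
  move=> wA; rewrite /spoke (bigD1 w) ?inE //= eqxx big1 ?addr0 // => x.
  rewrite inE => /andP[xA xw]; case: eqP => // /setP/(_ x); rewrite !inE eqxx orbT.
  by rewrite (negPf xw); case: eqP xA => [->|]; rewrite ?uA.
have spoke0 : (forall w, w \notin A -> g != [set u; w]) -> spoke u g = 0.
  by move=> g0; rewrite /spoke big1 // => w; rewrite inE => /g0/negPf->.
have [<-|neg] := eqVneq.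
  rewrite spokeE // sgn_sqr // helm_diag // (_ : [set w | _] = A :\ u).
    by rewrite (cardsD1 u A) uA mulr1n natr1.
  by apply/setP=> w; rewrite !inE !domA uA (negPf vA) /= andbT [w == u]eq_sym;
    case: eqVneq => //= _; case: eqVneq => //= <-; rewrite (negPf vA).
rewrite add0r.
have [eg|/not_disjoint_ex[p pe pg]] := boolP [disjoint [set u; v] & g].
  rewrite (helm_disjoint R o (mem_edges uv) gE eg) spoke0 ?mulr0 // => w wA.
  by apply: contraTneq eg => ->; rewrite -setI_eq0; apply/set0Pn; exists u; rewrite !inE eqxx.
have [w pw defg] := edge_at gE pg.
case/set2P: pe pw defg => -> pw defg; last first.
  have wA : w \in A by move: pw; rewrite domA (negPf vA) => /andP[].
  have uw : u != w by apply: contraNneq neg => ->; rewrite defg setUC.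
  have vu : adj v u by rewrite adj_sym.
  rewrite defg setUC helm_angle // (dominated_adj uA uw) -defg.
  rewrite spoke0 ?mulr0 // => z zA; rewrite defg; apply/eqP=> /setP/(_ u).
  by rewrite !inE eqxx (negPf nuv) (negPf uw).
have vw : v != w by apply: contraNneq neg => ->; rewrite defg.
rewrite defg helm_angle // domA vw (negPf vA) /=; case: ifPn => wA; last by rewrite spokeE.
rewrite -defg spoke0 ?mulr0 // => z zA; rewrite defg; apply/eqP=> /setP/(_ w).
rewrite !inE eqxx orbT [w == u]eq_sym (negPf (adj_neq pw)) => /esym/eqP wz.
by rewrite -wz wA in zA.
Qed.

(* On edges from [A] to its complement, [q] is a sum of rank-one blocks, one for
   each vertex of [A]; on edges inside [A] it is scalar. *)
Lemma shifted_helm_sq e f : e \in edges G -> f \in edges G ->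
  let q e g := helm R o e g - #|A|%:R *+ (e == g) in
  \sum_(g in edges G) q e g * q g f = #|~: A|%:R * q e f.
Proof.
move=> eE fE q.
have qA u v g : u \in A -> v \in A -> u != v -> g \in edges G ->
    q [set u; v] g = #|~: A|%:R *+ ([set u; v] == g).
  move=> uA vA uv gE; rewrite /q helm_dominating_edge // -mulrnBl; congr (_ *+ _).
  by rewrite -(cardsC A) natrD addrAC subrr add0r.
have qS u v g : u \in A -> v \notin A -> g \in edges G ->
    q [set u; v] g = sgn R o u v * spoke u g.
  by move=> uA vA gE; rewrite /q helm_spoke // addrAC subrr add0r.
have sumA u v : u \in A -> v \in A -> u != v ->
    \sum_(g in edges G) q [set u; v] g * q g f = #|~: A|%:R * q [set u; v] f.
  move=> uA vA uv; have uvE := mem_edges (dominated_adj uA uv).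
  rewrite (bigD1 [set u; v]) //= {1}qA // eqxx big1 ?addr0 // => g /andP[gE ng].
  by rewrite qA // eq_sym (negPf ng) mul0r.
(* The vector [spoke u] has one entry of square 1 per vertex outside [A], so its squared norm is
   [#|~: A|]. *)
have sumS u v : u \in A -> v \notin A ->
    \sum_(g in edges G) q [set u; v] g * q g f = #|~: A|%:R * q [set u; v] f.
  move=> uA vA; rewrite qS // mulrCA.
  under eq_bigr => g gE do rewrite qS // -mulrA.
  rewrite -mulr_sumr; congr (_ * _).
  under eq_bigr => g gE do rewrite mulr_suml.
  rewrite exchange_big /= mulr_natl -sumr_const; apply: eq_bigr => w wA.
  rewrite inE in wA; have uw : u != w by apply: contraNneq wA => <-.
  have auw := dominated_adj uA uw.
  rewrite (bigD1 [set u; w]) ?mem_edges //= eqxx big1 ?addr0 => [|g /andP[_ /negPf->]].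
    by rewrite qS // mulrA sgn_sqr // mul1r.
  by rewrite mul0r.
case/edgesP: eE => u [v [uv ->]]; have nuv := adj_neq uv.
have [uA|uA] := boolP (u \in A).
  by have [vA|vA] := boolP (v \in A); [apply: sumA | apply: sumS].
have vA : v \in A by move: uv; rewrite domA (negPf uA) => /andP[].
by rewrite setUC; apply: sumS.
Qed.

(** With [B] the shift by [#|A|], the preceding lemma reads B^2 = [#|~: A|] B, and [#|G|] is [#|A|]
    + [#|~: A|]. *)
Lemma helmholtzian_annul :
  (helmholtzian R o - #|A|%:R%:M) *m (helmholtzian R o - #|G|%:R%:M) = 0.
Proof.
set B := _ - #|A|%:R%:M.
have -> : helmholtzian R o - #|G|%:R%:M = B - #|~: A|%:R%:M.
  by rewrite /B -(cardsC A) natrD raddfD /= opprD addrA.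
apply/eqP; rewrite mulmxBr subr_eq0 mul_mx_scalar; apply/eqP/matrixP=> i j.
have BE k l : B k l = helm R o (enum_val k) (enum_val l)
    - #|A|%:R *+ (enum_val k == enum_val l).
  by rewrite !mxE -helmholtzianE !mxE (inj_eq enum_val_inj).
rewrite mxE [RHS]mxE BE.
rewrite -(shifted_helm_sq (enum_valP i) (enum_valP j)) [RHS]big_enum_val.
by apply: eq_bigr => k _; rewrite !BE.
Qed.

(** Two edges from a vertex of [A] to distinct vertices outside [A] give a nonzero off-diagonal
    entry. *)
Lemma helmholtzian_not_scalar (c : R) : A != set0 -> (1 < #|~: A|)%N ->
  helmholtzian R o != c%:M.
Proof.
case/set0Pn=> u uA /card_gt1P[v [w [vA wA vw]]]; rewrite !inE in vA wA.
have [uv uw] : u != v /\ u != w.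
  by split; [apply: contraNneq vA | apply: contraNneq wA] => <-.
have [auv auw] := (dominated_adj uA uv, dominated_adj uA uw).
have [eE fE] := (mem_edges auv, mem_edges auw).
apply/eqP=> /matrixP/(_ (enum_rank_in eE [set u; v]) (enum_rank_in eE [set u; w])).
rewrite helmholtzianE !enum_rankK_in // helm_angle // domA vw (negPf vA) (negPf wA) /= mxE.
case: eqP => [/(congr1 enum_val)|_ /eqP].
  rewrite !enum_rankK_in // => /setP/(_ v).
  by rewrite !inE eqxx orbT [v == u]eq_sym (negPf uv) (negPf vw).
have s0 x : adj u x -> sgn R o u x != 0.
  by move=> ux; apply: contra_eq_neq (sgn_sqr R o ux) => ->; rewrite mul0r eq_sym oner_eq0.
by rewrite mulr0n mulf_eq0 (negPf (s0 _ auv)) (negPf (s0 _ auw)).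
Qed.

Lemma helmholtzian_complete : A = setT -> helmholtzian R o = #|G|%:R%:M.
Proof.
move=> AT; apply/matrixP=> i j; rewrite helmholtzianE mxE -(inj_eq enum_val_inj).
have /edgesP[u [v [/adj_neq uv defe]]] := enum_valP i.
by rewrite defe helm_dominating_edge ?enum_valP // AT in_setT.
Qed.

End Dominated.

(** * From matrices and dominating sets to the equivalence *)

(** A single vertex outside [A] is adjacent to all others, so the graph is complete; this case must
    be excluded to get [s] at least 2. *)
Lemma dominated_by_setT (G : sgraph) (A : {set G}) :
  dominated_by A -> (#|~: A| <= 1)%N -> dominated_by [set: G].
Proof.
move=> domA /card_le1_eqP cA x y; rewrite !inE andbT domA.
case: eqVneq => //= /eqP xy; apply: contra_notT xy; rewrite negb_or => /andP[xA yA].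
by apply: cA; rewrite inE.
Qed.

Lemma eigenvalue_annul2 (F : fieldType) n (M : 'M[F]_n) (a b : F) :
    (M - a%:M) *m (M - b%:M) = 0 -> M != a%:M -> M != b%:M ->
  forall x, eigenvalue M x <-> x = a \/ x = b.
Proof.
move=> Mab Ma Mb x; split=> [/eigenvalueP[v vM v0]|].
  have vMc c : v *m (M - c%:M) = (x - c) *: v.
    by rewrite mulmxBr vM mul_mx_scalar scalerBl.
  have /eqP : v *m ((M - a%:M) *m (M - b%:M)) = 0 by rewrite Mab mulmx0.
  rewrite mulmxA vMc -scalemxAl vMc scalerA scaler_eq0 (negPf v0) orbF mulf_eq0.
  by rewrite !subr_eq0 => /orP[]/eqP; [left | right].
(* The nonzero rows of [M - c%:M] lie in the left kernel of [M - d%:M], the eigenspace of [d]. *)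
have evP c d : (M - c%:M) *m (M - d%:M) = 0 -> M != c%:M -> eigenvalue M d.
  move=> /sub_kermxP sMc; rewrite -subr_eq0; apply: contraNN => /eqP ker0.
  by rewrite -submx0 -ker0.
case=> ->; last exact: (evP a).
apply: (evP b) => //; rewrite -[RHS]Mab; apply: comm_mxB.
  by apply/comm_mx_sym/comm_mxB; [exact: comm_mx_refl | exact: comm_mx_scalar].
exact: comm_mx_scalar.
Qed.

(** Off the diagonal, the hypothesis says that H^2 equals (a + b) H. *)
Lemma helmholtzian_sq_orth (R : realFieldType) (G : sgraph) (o : orientation G)
    (a b : R) (H := helmholtzian R o) : (H - a%:M) *m (H - b%:M) = 0 ->
  forall e f, e \in edges G -> f \in edges G -> e != f -> helm R o e f = 0 ->
  \sum_(g in edges G) helm R o e g * helm R o g f = 0.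
Proof.
have HE i j : H i j = helm R o (enum_val i) (enum_val j) by exact: helmholtzianE.
clearbody H; rewrite mulmxBr mulmxBl mul_mx_scalar mul_scalar_mx => Hab e f eE fE nef hef.
move/matrixP/(_ (enum_rank_in eE e) (enum_rank_in eE f)): Hab.
have nij : (enum_rank_in eE e == enum_rank_in eE f) = false.
  by apply: contraNF nef => /eqP/(congr1 enum_val); rewrite !enum_rankK_in // => ->.
rewrite !mxE nij !HE !enum_rankK_in // hef subr0 !mulr0 !subr0 => sq0; rewrite -[RHS]sq0 [LHS]big_enum_val.
by apply: eq_bigr => k _; rewrite !HE !enum_rankK_in.
Qed.

Lemma isomorphic_join_dominated (G : sgraph) :
  (exists t s : nat, [/\ (1 <= t)%N, (2 <= s)%N
    & isomorphic G (graph_join (complete_graph t) (edgeless_graph s))])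
  <-> exists A : {set G}, [/\ dominated_by A, A != set0 & (1 < #|~: A|)%N].
Proof.
split=> [[t [s [t1 s2 [f bf fadj]]]] | [A [domA A0 cA]]].
  have [k fK kK] := bf.
  exists [set x | if f x is inl _ then true else false]; split.
  - move=> x y; rewrite -fadj !inE -(inj_eq (bij_inj bf)).
    by case: (f x) (f y) => [i|i] [j|j] //=; rewrite ?andbT ?andbF.
  - by apply/set0Pn; exists (k (inl (Ordinal t1))); rewrite inE kK.
  apply/card_gt1P.
  exists (k (inr (Ordinal (ltnW s2)))), (k (inr (Ordinal s2))); rewrite !inE !kK.
  by split=> //; rewrite (inj_eq (can_inj kK)).
exists #|A|, #|~: A|; split; rewrite ?card_gt0 //.
pose k (p : 'I_#|A| + 'I_#|~: A|) : G :=
  match p with inl i => enum_val i | inr j => enum_val j end.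
have kA p : (k p \in A) = if p is inl _ then true else false.
  case: p => i /=; first exact: enum_valP.
  by apply/negbTE; have := enum_valP i; rewrite inE.
have injk : injective k.
  move=> p q kpq; have := kA p; rewrite kpq kA.
  by case: p q kpq => [i|i] [j|j] //= /enum_val_inj->.
have [f fK kK] : bijective k.
  (* Injectivity suffices, since [A] and its complement together count all vertices. *)
  by apply: inj_card_bij => //; rewrite card_sum !card_ord cardsC.
exists f; first by exists k.
move=> x y; rewrite -[in RHS](kK x) -[in RHS](kK y) domA !kA (inj_eq injk).
by case: (f x) (f y) => [i|i] [j|j] //=; rewrite ?andbT ?andbF.
Qed.

Theorem theorem3p9 (R : rcfType) (G : sgraph) (o : orientation G)
    (G_connected : connected_graph G) (G_edge : edges G != set0) :
  two_distinct_eigenvalues (helmholtzian R o) <->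
  exists t s : nat, [/\ (1 <= t)%N, (2 <= s)%N
    & isomorphic G (graph_join (complete_graph t) (edgeless_graph s))].
Proof.
rewrite isomorphic_join_dominated; split=> [[a [b [nab spH]]] | [A [domA A0 cA]]].
  have symH : (helmholtzian R o)^T = helmholtzian R o.
    by apply/matrixP=> i j; rewrite mxE !helmholtzianE helmC.
  have Hab := sym_two_eigenvalues_annul symH (fun x => proj1 (spH x)).
  have := exists_dominating (helmholtzian_sq_orth Hab) G_connected.
  set A := [set x : G | _] => domA; exists A; split=> //.
    (* Vertices outside [A] are independent, so any edge has an end in [A]. *)
    case/set0Pn: G_edge => e /edgesP[u [v [+ _]]].
    by rewrite domA => /andP[_ /orP[uA|vA]]; apply/set0Pn; [exists u | exists v].
  (* Otherwise the graph is complete and the matrix scalar, which forces [a = b]. *)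
  rewrite ltnNge; apply: contra_neqN nab => /(dominated_by_setT domA) domT.
  have HE := helmholtzian_complete R o domT erefl.
  have ev x : eigenvalue (helmholtzian R o) x -> x = #|G|%:R.
    move=> /eigenvalueP[v]; rewrite HE mul_mx_scalar => vx v0.
    have /eqP := vx; rewrite eq_sym -subr_eq0 -scalerBl scaler_eq0 (negPf v0) orbF.
    by rewrite subr_eq0 => /eqP.
  have [ea eb] : a = #|G|%:R /\ b = #|G|%:R.
    by split; apply: ev; apply/spH; [left | right].
  by rewrite ea eb.
exists #|A|%:R, #|G|%:R; split.
  rewrite eqr_nat -(cardsC A) -[X in X != _]addn0 eqn_add2l eq_sym.
  by rewrite -lt0n (ltn_trans _ cA).
apply: eigenvalue_annul2; first exact: helmholtzian_annul.
  exact: helmholtzian_not_scalar A0 cA.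
exact: helmholtzian_not_scalar A0 cA.
Qed.
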